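(* Let $z_1,z_2\in\mathbb C\setminus\mathbb R$, and let $\pi_1,\pi_2$ be Hermitian projections of $\mathbb C^n$. If $$\phi=(z_2-z_1)I+(z_1-\bar z_1)\pi_1-(z_2-\bar z_2)\pi_2$$ is non-singular, then (i) $\tau_i=\phi\pi_i\phi^{-1}$ is a Hermitian projection for $i=1,2$; (ii) $g_{z_2,\tau_2}g_{z_1,\pi_1}=g_{z_1,\tau_1}g_{z_2,\pi_2}$; (iii) if $\tau_1,\tau_2$ are Hermitian projections with $g_{z_2,\tau_2}g_{z_1,\pi_1}=g_{z_1,\tau_1}g_{z_2,\pi_2}$, then $\pi_1,\pi_2$ and $\tau_1,\tau_2$ are related as in (i), i.e. $\tau_i=\phi\pi_i\phi^{-1}$ for $i=1,2$.
   Context: A Hermitian projection of $\mathbb C^n$ is a matrix $\pi$ with $\pi^*=\pi=\pi^2$. For $z\in\mathbb C\setminus\mathbb R$ and a Hermitian projection $\pi$, $g_{z,\pi}(\lambda)=\pi+\frac{\lambda-z}{\lambda-\bar z}(I-\pi)$, a rational matrix function of $\lambda$. *)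

(* Defs.v *)
From mathcomp Require Export all_boot all_order all_algebra.
From mathcomp Require Export reals.
From mathcomp.real_closed Require Export complex.

Set Implicit Arguments.
Unset Strict Implicit.
Unset Printing Implicit Defensive.

Import Order.TTheory GRing.Theory Num.Theory.

Local Open Scope ring_scope.
Local Open Scope sesquilinear_scope.

Definition hermitian_projection (R : realType) (n : nat) (p : 'M[R[i]]_n) : Prop :=
  p ^t* = p /\ p *m p = p.

(* The field C(lambda) of rational functions. *)
Definition ratfun (R : realType) : fieldType := {fraction {poly R[i]}}.

Definition cst (R : realType) : R[i] -> ratfun R :=
  @tofrac {poly R[i]} \o polyC.

Definition lambda (R : realType) : ratfun R := @tofrac {poly R[i]} 'X.

(* An equation between products of such matrices is an identity of rational matrix
   functions of lambda, so poles of the factors (which may cancel in a product)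
   play no role. *)
Definition g (R : realType) (n : nat) (z : R[i]) (p : 'M[R[i]]_n) :
    'M[ratfun R]_n :=
  map_mx (@cst R) p
  + ((lambda R - cst z) / (lambda R - cst z^*)) *: (1%:M - map_mx (@cst R) p).

Definition phi (R : realType) (n : nat) (z1 z2 : R[i]) (p1 p2 : 'M[R[i]]_n) :
    'M[R[i]]_n :=
  (z2 - z1)%:M + (z1 - z1^*) *: p1 - (z2 - z2^*) *: p2.

(* Main.v *)
From HB Require Import structures.
Require Import Defs.
From mathcomp Require Import ring.
Import Order.TTheory GRing.Theory Num.Theory.
Local Open Scope ring_scope.

(** Clearing denominators turns each factor into a monic linear polynomial:
    (lambda - z^* ) g_{z,p} = lambda + X, with X = (z - z^* ) p - z a constant
    matrix, and phi = X1 - X2.  Both products in the exchange relation have the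
    same scalar denominator, so it says that
    (lambda + Y2) (lambda + X1) = (lambda + Y1) (lambda + X2) as polynomials,
    that is, Y2 + X1 = Y1 + X2 and Y2 X1 = Y1 X2.  Eliminating either Y from
    these two equations gives Y_i phi = phi X_i, and conversely
    Y_i = phi X_i phi^-1 solves them ([exchange_conj]).  As z is not real, this
    is the same as conjugating the projections themselves, whence existence and
    uniqueness.

    That phi p_i phi^-1 is again Hermitian amounts to p_i commuting with
    phi^* phi.  This product equals a scalar minus a multiple of (p1 - p2)^2
    ([phi_adj_mul]), and the square of a difference of two idempotents commutes
    with both of them. *)

(** * Hermitian projections and conjugation *)

Local Open Scope sesquilinear_scope.

Section Adjoint.
Context {C : numClosedFieldType} {n : nat}.
Implicit Types A B F p q : 'M[C]_n.

Lemma adjmxM A B : (A *m B)^t* = B^t* *m A^t*.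
Proof. by rewrite trmx_mul map_mxM. Qed.

Lemma adjmxV A : (invmx A)^t* = invmx (A^t*).
Proof. by rewrite trmx_inv map_invmx. Qed.

Lemma sqr_sub_idem p q : p *m p = p -> q *m q = q ->
  (p - q) *m (p - q) = p + q - p *m q - q *m p.
Proof.
move=> pp qq; rewrite mulmxBl !mulmxBr pp qq opprB -!addrA; congr (_ + _).
by rewrite addrC -!addrA; congr (_ + _); rewrite addrC.
Qed.

(** Both products equal p - p q p. *)
Lemma sqr_sub_idem_comm p q : p *m p = p -> q *m q = q ->
  p *m ((p - q) *m (p - q)) = (p - q) *m (p - q) *m p.
Proof.
move=> pp qq; rewrite sqr_sub_idem // !(mulmxBl, mulmxBr, mulmxDl, mulmxDr).
rewrite !mulmxA pp addrK -[q *m p *m p]mulmxA pp.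
by rewrite (addrAC p (q *m p)) addrK.
Qed.

Lemma comm_scalar_sub A B (a b : C) : A *m B = B *m A ->
  A *m (a%:M - b *: B) = (a%:M - b *: B) *m A.
Proof.
by move=> cAB; rewrite mulmxBr mulmxBl scalar_mxC -scalemxAl -scalemxAr cAB.
Qed.

(** The adjoint of F A F^-1 is F^*^-1 A F^*, and multiplying by F^* on the left
    and by F on the right turns the desired equality into A F^* F = F^* F A. *)
Lemma conj_hermitian A F : F \in unitmx -> A^t* = A ->
  A *m (F^t* *m F) = F^t* *m F *m A ->
  (F *m A *m invmx F)^t* = F *m A *m invmx F.
Proof.
move=> uF hA cA.
have uF' : F^t* \in unitmx by rewrite map_unitmx unitmx_tr.
rewrite !adjmxM adjmxV hA.
apply: (can_inj (mulKmx uF')); rewrite mulKVmx //.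
by rewrite !mulmxA -cA !mulmxA mulmxK.
Qed.

Lemma conj_idem p F : F \in unitmx -> p *m p = p ->
  F *m p *m invmx F *m (F *m p *m invmx F) = F *m p *m invmx F.
Proof. by move=> uF pp; rewrite !mulmxA mulmxKV // -(mulmxA F) pp. Qed.

End Adjoint.

(** * Exchanging two linear factors *)

(** The two equations compare the coefficients of
    (lambda + Y2) (lambda + X1) and (lambda + Y1) (lambda + X2).  The first one
    says Y1 - Y2 = X1 - X2; substituting Y2 or Y1 from it into the second gives
    the two intertwining relations. *)
Lemma exchange_conj {K : fieldType} {n : nat} {X1 X2 : 'M[K]_n} (Y1 Y2 : 'M[K]_n) :
  X1 - X2 \in unitmx ->
  Y2 + X1 = Y1 + X2 /\ Y2 *m X1 = Y1 *m X2 <->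
  Y1 *m (X1 - X2) = (X1 - X2) *m X1 /\ Y2 *m (X1 - X2) = (X1 - X2) *m X2.
Proof.
move=> uF; split=> [[eD eM]|[e1 e2]].
  have eF : X1 - X2 = Y1 - Y2.
    by apply/eqP; rewrite subr_eq addrAC eq_sym subr_eq -eD addrC.
  by rewrite {2 4}eF !mulmxBr !mulmxBl eM.
have eF : Y1 - Y2 = X1 - X2.
  (* Subtracting the hypotheses gives (Y1 - Y2) F = F F for F = X1 - X2. *)
  by apply: (can_inj (mulmxK uF)); rewrite mulmxBl e1 e2 -mulmxBr.
split; first by apply/eqP; rewrite -subr_eq -addrA -eF addrC subrK.
move: e1; rewrite -eF mulmxBl eF mulmxBr => /addrI/oppr_inj.
by move=> ->.
Qed.

(** Freeness of 1 and l over the constants is what allows comparing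
    coefficients; it holds for an indeterminate l. *)
Lemma linear_mul_eq {K L : fieldType} (f : {rmorphism K -> L}) (l : L)
    {n : nat} (X1 X2 Y1 Y2 : 'M[K]_n) :
  (forall a b a' b', l * f a + f b = l * f a' + f b' -> a = a' /\ b = b') ->
  (l%:M + map_mx f Y2) *m (l%:M + map_mx f X1) =
  (l%:M + map_mx f Y1) *m (l%:M + map_mx f X2) <->
  Y2 + X1 = Y1 + X2 /\ Y2 *m X1 = Y1 *m X2.
Proof.
move=> free.
have expand X Y : (l%:M + map_mx f Y) *m (l%:M + map_mx f X) =
    (l * l)%:M + (l *: map_mx f (Y + X) + map_mx f (Y *m X)).
  rewrite mulmxDl !mulmxDr !mul_scalar_mx mul_mx_scalar scale_scalar_mx.
  by rewrite map_mxD map_mxM scalerDr -!addrA; congr (_ + _); rewrite addrCA.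
rewrite !expand; split=> [/addrI|[-> ->] //].
move: (Y2 + X1) (Y2 *m X1) (Y1 + X2) (Y1 *m X2) => A B A' B' /matrixP e.
by split; apply/matrixP=> i j; have := e i j; rewrite !mxE => /free [].
Qed.

Lemma scale_mul_eq {L : fieldType} {n : nat} (a b : L) (M N P Q : 'M[L]_n) :
  a != 0 -> b != 0 ->
  (a *: M) *m (b *: N) = (b *: P) *m (a *: Q) <-> M *m N = P *m Q.
Proof.
move=> a0 b0; rewrite -!scalemxAl -!scalemxAr !scalerA (mulrC b).
by split=> [|-> //]; apply: scalerI; rewrite mulf_neq0.
Qed.

(** * Clearing denominators *)

Section Rational.
Context {R : realType}.
Local Notation C := (R[i]).

HB.instance Definition _ := GRing.RMorphism.copy (@cst R)
  (@tofrac {poly R[i]} \o polyC).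

Lemma lambda_linear_inj (a b a' b' : C) :
  lambda R * cst a + cst b = lambda R * cst a' + cst b' -> a = a' /\ b = b'.
Proof.
rewrite /lambda /cst /= -!rmorphM -!rmorphD /= => /eqP.
rewrite tofrac_eq => /eqP /polyP e.
by split; [have := e 1%N | have := e 0%N];
  rewrite !coefD !coefXM !coefC /= ?add0r ?addr0.
Qed.

Lemma lambda_sub_neq0 (z : C) : lambda R - cst z != 0.
Proof. by rewrite /lambda /cst /= -rmorphB /= tofrac_eq0 polyXsubC_eq0. Qed.

(** The constant coefficient of the linear polynomial (lambda - z^* ) g_{z,p};
    its leading coefficient is 1. *)
Definition shift {n} (z : C) (p : 'M[C]_n) : 'M[C]_n := (z - z^*) *: p - z%:M.

Lemma clear_denominator {n : nat} (z : C) (p : 'M[C]_n) :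
  (lambda R - cst z^*) *: g z p = (lambda R)%:M + map_mx (@cst R) (shift z p).
Proof.
rewrite /g /shift scalerDr scalerA mulrC divfK ?lambda_sub_neq0 //.
rewrite map_mxB map_mxZ map_scalar_mx /= rmorphB /=.
by apply/matrixP=> i j; rewrite !mxE; ring.
Qed.

Lemma g_mul_eq {n : nat} (z1 z2 : C) (p1 p2 s1 s2 : 'M[C]_n) :
  g z2 s2 *m g z1 p1 = g z1 s1 *m g z2 p2 <->
  shift z2 s2 + shift z1 p1 = shift z1 s1 + shift z2 p2 /\
  shift z2 s2 *m shift z1 p1 = shift z1 s1 *m shift z2 p2.
Proof.
apply: iff_trans (linear_mul_eq (@cst R) (lambda R) _ _ _ _ lambda_linear_inj).
rewrite -!clear_denominator; apply: iff_sym.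
exact: scale_mul_eq _ _ _ _ (lambda_sub_neq0 z2^*) (lambda_sub_neq0 z1^*).
Qed.

Lemma phi_shift {n : nat} (z1 z2 : C) (p1 p2 : 'M[C]_n) :
  phi z1 z2 p1 p2 = shift z1 p1 - shift z2 p2.
Proof.
by apply/matrixP=> i j; rewrite !mxE; ring.
Qed.

(** The parameter must be non-real here: for real z the matrix X does not
    depend on p. *)
Lemma shift_intertwine {n : nat} (z : C) (p s F : 'M[C]_n) : z \isn't Num.real ->
  shift z s *m F = F *m shift z p <-> s *m F = F *m p.
Proof.
move=> hz; rewrite /shift mulmxBl mulmxBr scalar_mxC -scalemxAl -scalemxAr.
split=> [/addIr|-> //]; apply: scalerI.
by rewrite subr_eq0 eq_sym -CrealE.
Qed.

(** * The adjoint of phi *)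

(** The part H = (z1 - z1^* ) p1 - (z2 - z2^* ) p2 of phi is skew-Hermitian, as
    z - z^* is imaginary.  The terms linear in H, which come with the coefficient
    (z1 - z1^* ) - (z2 - z2^* ), cancel the squares of z1 - z1^* and z2 - z2^* in
    H H and leave only multiples of (z1 - z1^* ) (z2 - z2^* ). *)
Lemma phi_adj_mul {n : nat} (z1 z2 : C) (p1 p2 : 'M[C]_n) :
  hermitian_projection p1 -> hermitian_projection p2 ->
  (phi z1 z2 p1 p2)^t* *m phi z1 z2 p1 p2 =
  ((z2 - z1)^* * (z2 - z1))%:M
  - ((z1 - z1^*) * (z2 - z2^*)) *: ((p1 - p2) *m (p1 - p2)).
Proof.
move=> [h1 i1] [h2 i2].
set F := phi _ _ _ _; pose a1 := z1 - z1^*; pose a2 := z2 - z2^*.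
pose H := a1 *: p1 - a2 *: p2.
have eF : F = (z2 - z1)%:M + H by rewrite /F /phi -addrA.
have a1C : a1^* = - a1 by rewrite rmorphB /= conjCK opprB.
have a2C : a2^* = - a2 by rewrite rmorphB /= conjCK opprB.
have hH : H^t* = - H.
  by rewrite /H !raddfB /= !linearZ /= !map_mxZ /= h1 h2 a1C a2C !scaleNr !scalerN.
have eFa : F^t* = ((z2 - z1)^*)%:M - H.
  by rewrite eF linearD /= tr_scalar_mx map_mxD map_scalar_mx hH.
have HH : H *m H = (a1 * a1) *: p1 + (a2 * a2) *: p2
                   - (a1 * a2) *: (p1 *m p2 + p2 *m p1).
  rewrite /H mulmxBl !mulmxBr -!scalemxAl -!scalemxAr i1 i2 !scalerA.
  by apply/matrixP=> i j; rewrite !mxE; ring.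
rewrite sqr_sub_idem // eFa eF mulmxBl 2!(mulmxDr _ _ H) HH.
rewrite !mul_scalar_mx mul_mx_scalar scale_scalar_mx /H rmorphB /=.
by apply/matrixP=> i j; rewrite !mxE /a1 /a2; ring.
Qed.

Lemma phi_conj_hermitian_projection {n : nat} (z1 z2 : C) (p1 p2 : 'M[C]_n) :
  hermitian_projection p1 -> hermitian_projection p2 ->
  phi z1 z2 p1 p2 \in unitmx ->
  let F := phi z1 z2 p1 p2 in
  hermitian_projection (F *m p1 *m invmx F) /\
  hermitian_projection (F *m p2 *m invmx F).
Proof.
move=> hp1 hp2 uF F; have FF := phi_adj_mul z1 z2 _ _ hp1 hp2.
have [[h1 i1] [h2 i2]] := (hp1, hp2).
have c1 := sqr_sub_idem_comm _ _ i1 i2; have := sqr_sub_idem_comm _ _ i2 i1.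
rewrite -(opprB p1) mulmxN mulNmx opprK => c2.
split; split; try exact: conj_idem.
  by apply: conj_hermitian => //; rewrite FF; apply: comm_scalar_sub.
by apply: conj_hermitian => //; rewrite FF; apply: comm_scalar_sub.
Qed.

End Rational.

Local Close Scope sesquilinear_scope.

(** * Exchange of two simple factors *)

Theorem mainTheorem10 (R : realType) (n : nat) (z1 z2 : R[i])
    (p1 p2 : 'M[R[i]]_n)
    (hz1 : z1 \isn't Num.real) (hz2 : z2 \isn't Num.real)
    (hp1 : hermitian_projection p1) (hp2 : hermitian_projection p2)
    (hphi : phi z1 z2 p1 p2 \in unitmx) :
  let F := phi z1 z2 p1 p2 in
  let t1 := F *m p1 *m invmx F in
  let t2 := F *m p2 *m invmx F in
  [/\ hermitian_projection t1 /\ hermitian_projection t2,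
      g z2 t2 *m g z1 p1 = g z1 t1 *m g z2 p2
    & forall s1 s2 : 'M[R[i]]_n,
        hermitian_projection s1 -> hermitian_projection s2 ->
        g z2 s2 *m g z1 p1 = g z1 s1 *m g z2 p2 ->
        s1 = t1 /\ s2 = t2].
Proof.
move=> F t1 t2.
have exchange s1 s2 : g z2 s2 *m g z1 p1 = g z1 s1 *m g z2 p2 <->
    s1 *m F = F *m p1 /\ s2 *m F = F *m p2.
  have uX := hphi; rewrite phi_shift in uX.
  have e1 := shift_intertwine _ p1 s1 F hz1; have e2 := shift_intertwine _ p2 s2 F hz2.
  rewrite -e1 -e2 /F phi_shift; apply: iff_trans (exchange_conj _ _ uX).
  exact: g_mul_eq.
split; first exact: phi_conj_hermitian_projection.
  by apply/exchange; rewrite /t1 /t2 !mulmxKV.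
by move=> s1 s2 _ _ /exchange [e1 e2]; rewrite /t1 /t2 -e1 -e2 !mulmxK.
Qed.
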